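(* Let $R$ be a Noetherian commutative ring and let $\lambda$ be an infinite cardinal. Then $R^{\lambda}$ is a projective $R$-module if and only if $R$ is Artinian.
   Context: Rings are unital and non-zero. $R^{\lambda}$ is the $R$-module of all functions $\lambda\to R$, i.e. the direct product of $\lambda$ copies of $R$; it is isomorphic to the dual $\mathrm{Hom}_R(R^{[\lambda]},R)$ of the free module $R^{[\lambda]}$ of rank $\lambda$ (the direct sum of $\lambda$ copies of $R$). *)

(* Defs.v *)
From HB Require Import structures.
From mathcomp Require Import all_boot all_order all_algebra.
From mathcomp Require Import all_classical.

Set Implicit Arguments.
Unset Strict Implicit.
Unset Printing Implicit Defensive.

Import GRing.Theory.

Local Open Scope classical_set_scope.
Local Open Scope ring_scope.

(* The library's [idealr_closed] excludes the unit ideal, so ideals are taken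
   to be the submodules of the regular module [R^o] instead. *)
Definition is_ideal (R : comNzRingType) (J : set R) : Prop :=
  GRing.submod_closed [in (J : set R^o)].

Definition noetherian (R : comNzRingType) : Prop :=
  forall J : nat -> set R,
    (forall n, is_ideal (J n)) -> (forall n, J n `<=` J n.+1) ->
    exists m, forall n, (m <= n)%N -> J n = J m.

Definition artinian (R : comNzRingType) : Prop :=
  forall J : nat -> set R,
    (forall n, is_ideal (J n)) -> (forall n, J n.+1 `<=` J n) ->
    exists m, forall n, (m <= n)%N -> J n = J m.

Definition projective (R : nzRingType) (P : lmodType R) : Prop :=
  forall (M N : lmodType R) (g : {linear M -> N}) (f : {linear P -> N}),
    (forall y : N, exists x : M, g x = y) ->
    exists h : {linear P -> M}, forall p : P, g (h p) = f p.

(* Main.v *)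
(* Suppose R is Artinian. Write 1 as a sum of primitive idempotents e; it is
   enough to lift e f for each e. The ring e R is local with nil maximal ideal m.
   A maximal family of elements of R^L independent modulo m spans e R^L, by
   climbing along ideals I with m x inside I, and is free over e R, by looking at
   a simple subquotient of the ideal of coefficients. Hence e R^L is free.

   Suppose R^L is projective but R is not Artinian. There are a prime p and an x,
   nonzero and not invertible modulo p. Take a dual basis (phi_i, i) of R^L. A
   gliding hump argument due to Chase shows that for some K and n almost all phi_i
   map x^K times the n-th tail of R^L into the intersection of the p + (x^m), which
   is p by Noetherianity. So modulo p the n-th tail embeds into a free module of
   finite rank d, and the identity matrix of size d + 1 factors through it. *)

From HB Require Import structures.
Require Import Defs.
From mathcomp Require Import all_boot all_order all_algebra.
From mathcomp Require Import all_classical.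
From mathcomp Require Import ring.

Set Implicit Arguments.
Unset Strict Implicit.
Unset Printing Implicit Defensive.

Import GRing.Theory.

Local Open Scope classical_set_scope.
Local Open Scope ring_scope.

(** * Ideals *)

Section Ideals.
Variable R : comNzRingType.
Implicit Types (I J : set R) (a x y z : R).

Lemma idealP J :
  is_ideal J <->
  J 0 /\ forall a x y, J x -> J y -> J (a * x + y).
Proof.
split=> [[J0 JD]|[J0 JD]]; split.
- by move: J0; rewrite inE.
- move=> a x y Jx Jy.
  have := JD a x y; rewrite !inE; exact.
- by rewrite inE.
- by move=> a x y; rewrite !inE; exact: JD.
Qed.

Lemma ideal0 J : is_ideal J -> J 0.
Proof. by move=> /idealP[]. Qed.

Lemma idealD J x y : is_ideal J -> J x -> J y -> J (x + y).
Proof. by move=> /idealP[_ JD] Jx Jy; rewrite -[x]mul1r; exact: JD. Qed.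

Lemma idealMl J a x : is_ideal J -> J x -> J (a * x).
Proof. by move=> /idealP[J0 JD] Jx; rewrite -[a * x]addr0; exact: JD. Qed.

Lemma idealMr J a x : is_ideal J -> J x -> J (x * a).
Proof. by rewrite mulrC; exact: idealMl. Qed.

Lemma idealN J x : is_ideal J -> J x -> J (- x).
Proof. by rewrite -mulN1r; exact: idealMl. Qed.

Lemma idealB J x y : is_ideal J -> J x -> J y -> J (x - y).
Proof. by move=> iJ Jx Jy; apply: idealD => //; exact: idealN. Qed.

Lemma ideal_sum (T : eqType) J (s : seq T) (F : T -> R) : is_ideal J ->
  (forall i, i \in s -> J (F i)) -> J (\sum_(i <- s) F i).
Proof.
move=> iJ JF; rewrite big_seq; elim/big_ind : _ => //; first exact: ideal0.
by move=> x y; exact: idealD.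
Qed.

Definition adjoin J x : set R := [set y | exists j a, J j /\ y = j + a * x].

Lemma ideal_adjoin J x : is_ideal J -> is_ideal (adjoin J x).
Proof.
move=> iJ; apply/idealP; split.
  by exists 0, 0; rewrite mul0r addr0; split=> //; exact: ideal0.
move=> a _ _ [j [b [Jj ->]]] [k [c [Jk ->]]].
exists (a * j + k), (a * b + c); split; last by ring.
by apply: idealD => //; exact: idealMl.
Qed.

Lemma sub_adjoin J x : J `<=` adjoin J x.
Proof. by move=> y Jy; exists y, 0; rewrite mul0r addr0. Qed.

Lemma mem_adjoin J x : is_ideal J -> adjoin J x x.
Proof. by move=> /ideal0 J0; exists 0, 1; rewrite mul1r add0r. Qed.

Lemma adjoin_sub I J x : is_ideal J -> I `<=` J -> J x -> adjoin I x `<=` J.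
Proof.
move=> iJ IJ Jx _ [j [a [Ij ->]]].
by apply: idealD => //; [exact: IJ|exact: idealMl].
Qed.

Definition colon J x : set R := [set y | J (y * x)].

Lemma ideal_colon J x : is_ideal J -> is_ideal (colon J x).
Proof.
move=> iJ; apply/idealP; split; first by rewrite /colon /= mul0r; exact: ideal0.
move=> a y z Jy Jz; rewrite /colon /= mulrDl -mulrA.
by apply: idealD => //; exact: idealMl.
Qed.

Lemma sub_colon J x : is_ideal J -> J `<=` colon J x.
Proof. by move=> iJ y Jy; exact: idealMr. Qed.

Lemma ideal_set0 : is_ideal [set (0 : R)].
Proof. by apply/idealP; split=> //= a x y -> ->; rewrite mulr0 addr0. Qed.

Lemma nonincreasing_ideals (J : nat -> set R) :
  (forall n, J n.+1 `<=` J n) -> forall m n, (m <= n)%N -> J n `<=` J m.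
Proof.
move=> JS m n /subnK <-; elim: (n - m)%N => [//|k IH].
by apply: (subset_trans _ IH); exact: JS.
Qed.

(** If no member of [C] were maximal, dependent choice would give a strictly ascending chain of
    ideals. *)
Lemma noetherian_maximal (C : set (set R)) : noetherian R ->
  (exists J, is_ideal J /\ C J) ->
  exists J, [/\ is_ideal J, C J &
    forall J', is_ideal J' -> C J' -> J `<=` J' -> J' `<=` J].
Proof.
move=> nR [J0 [iJ0 CJ0]]; apply: contrapT => nomax.
pose T := {J : set R | is_ideal J /\ C J}.
have [J1 [JS1 JS2]] : exists f : nat -> T,
    f 0%N = exist _ J0 (conj iJ0 CJ0) /\
    forall n, sval (f n) `<` sval (f n.+1).
  suff next : forall X : T, {Y : T | sval X `<` sval Y}.
    by have [f] := dependent_choice next (exist _ J0 (conj iJ0 CJ0)); exists f.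
  move=> [J [iJ CJ]]; apply: cid; apply: contrapT => nX; apply: nomax.
  exists J; split=> // J' iJ' CJ' JJ' x Jx; apply: contrapT => nJx.
  apply: nX; exists (exist _ J' (conj iJ' CJ')); split=> //= /(_ x Jx).
  exact: nJx.
have [m mJ] := nR (fun n => sval (J1 n)) (fun n => proj1 (svalP (J1 n)))
  (fun n => proj1 (JS2 n)).
by case: (JS2 m) => _; apply; rewrite (mJ m.+1).
Qed.

Lemma artinian_pow_stable x : artinian R -> exists n y, x ^+ n = x ^+ n.+1 * y.
Proof.
move=> aR.
have iJ n : is_ideal [set y | exists a, y = x ^+ n * a].
  apply/idealP; split; first by exists 0; rewrite mulr0.
  by move=> a _ _ [b ->] [c ->]; exists (a * b + c); ring.
have [|m mJ] := aR _ iJ.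
  by move=> n _ [a ->]; exists (x * a); rewrite exprS; ring.
exists m; have /seteqP[_] := mJ m.+1 (leqnSn m).
by move=> /(_ (x ^+ m)) [|y ->]; [exists 1; rewrite mulr1|exists y].
Qed.

End Ideals.

(** * Artinian rings *)

Section PrimitiveIdempotent.
Variables (R : comNzRingType) (e : R).
Hypothesis ee : e * e = e.
Hypothesis e_neq0 : e <> 0.

(* Modulo [1 - e], i.e. in the ring [e * R], these are the nilpotent elements
   and the units. *)
Definition enil : set R := [set x | exists n, e * x ^+ n = 0].
Definition eunit : set R := [set x | exists z, e * (x * z) = e].

Hypothesis elocal : forall x, eunit x \/ enil x.

Lemma idem_mul_expr x n : e * x = e -> e * x ^+ n = e.
Proof.
by move=> ex; elim: n => [|n IH]; rewrite ?expr0 ?mulr1 // exprS mulrA ex IH.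
Qed.

Lemma eunit_not_enil x : eunit x -> ~ enil x.
Proof.
move=> [z ez] [n en]; apply: e_neq0.
by rewrite -(idem_mul_expr n ez) exprMn mulrA en mul0r.
Qed.

Lemma enilM a x : enil x -> enil (a * x).
Proof. by move=> [n en]; exists n; rewrite exprMn mulrCA en mulr0. Qed.

Lemma eunit_1B x : enil x -> eunit (1 - x).
Proof.
move=> [n en]; exists (\sum_(i < n) x ^+ i).
by rewrite -[1 - x]opprB mulNr -subrX1 opprB mulrBr en mulr1 subr0.
Qed.

(** If [x + y] had an inverse [z], then [x * z] would be [1 - z * y] up to the factor [e], a unit
    since [y] is nilpotent; so [x] would be a unit. *)
Lemma enilD x y : enil x -> enil y -> enil (x + y).
Proof.
move=> nx ny; have [[z ez]|//] := elocal (x + y).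
have [w ew] := eunit_1B (enilM z ny).
case: (@eunit_not_enil x) => //; exists (z * w).
have -> : e * (x * (z * w)) = (e * ((x + y) * z) - e * (z * y)) * w by ring.
by rewrite ez -{1}[e]mulr1 -mulrBr -mulrA.
Qed.

Lemma ideal_enil : is_ideal enil.
Proof.
apply/idealP; split; first by exists 1%N; rewrite expr1 mulr0.
by move=> a x y nx ny; apply: enilD => //; exact: enilM.
Qed.

Variable L : Type.
Local Notation V := (L -> R^o)%type.
Implicit Types (B : set V) (s : seq V) (v p : V).

(** A list [t] is a formal combination: [F := id] evaluates it in [V], another [F] gives its image
    under a would-be linear map. *)
Definition lincomb (M : lmodType R) (t : seq (R * V)) (F : V -> M) : M :=
  \sum_(x <- t) x.1 *: F x.2.

Definition combs B : set V :=
  [set v | exists2 t, (forall x, x \in t -> B x.2) & v = lincomb t id].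

(** Modulo [enil] this is linear independence over the residue field of [e * R]. *)
Definition independent B := forall s (c : V -> R),
  uniq s -> (forall b, b \in s -> B b) ->
  (forall l, enil (\sum_(b <- s) c b * b l)) ->
  forall b, b \in s -> enil (c b).

Lemma lincomb_undup (M : lmodType R) t (F : V -> M) :
  lincomb t F =
  \sum_(b <- undup (map snd t)) (\sum_(x <- t | x.2 == b) x.1) *: F b.
Proof.
under eq_bigr do rewrite scaler_suml.
rewrite (exchange_big_dep predT) //= /lincomb; apply: eq_big_seq => x xt.
rewrite -big_filter (_ : [seq i <- _ | _] = [:: x.2]) ?big_seq1 //.
rewrite (@eq_filter _ _ (pred1 x.2)) ?filter_pred1_uniq ?undup_uniq //.
  by rewrite mem_undup map_f.
by move=> b /=; rewrite eq_sym.
Qed.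

Lemma lincomb_cat (M : lmodType R) t u (F : V -> M) :
  lincomb (t ++ u) F = lincomb t F + lincomb u F.
Proof. by rewrite /lincomb big_cat. Qed.

Lemma lincomb_scale (M : lmodType R) a t (F : V -> M) :
  lincomb [seq (a * x.1, x.2) | x <- t] F = a *: lincomb t F.
Proof.
by rewrite /lincomb big_map scaler_sumr; apply: eq_bigr => x _; rewrite scalerA.
Qed.

Lemma combsD B v w : combs B v -> combs B w -> combs B (v + w).
Proof.
move=> [t tB ->] [u uB ->]; exists (t ++ u); last by rewrite lincomb_cat.
by move=> x; rewrite mem_cat => /orP[]; [exact: tB|exact: uB].
Qed.

Lemma combsZ B a v : combs B v -> combs B (a *: v).
Proof.
move=> [t tB ->]; exists [seq (a * x.1, x.2) | x <- t].
  by move=> _ /mapP[x xt ->]; exact: (tB x).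
by rewrite lincomb_scale.
Qed.

Lemma combs_sum B s (c : V -> R) : (forall b, b \in s -> B b) ->
  combs B (\sum_(b <- s) c b *: b).
Proof.
move=> sB; exists [seq (c b, b) | b <- s]; last by rewrite /lincomb big_map.
by move=> _ /mapP[b bs ->]; exact: sB.
Qed.

Lemma seq_in_chain (T : eqType) (F : set (set T)) (s : seq T) (X0 : set T) :
  F X0 -> total_on F subset ->
  (forall b, b \in s -> (\bigcup_(X in F) X) b) ->
  exists2 X, F X & forall b, b \in s -> X b.
Proof.
move=> FX0 Ftot; elim: s => [|b s IH] sF; first by exists X0.
have [|X FX Xs] := IH; first by move=> c cs; apply: sF; rewrite inE cs orbT.
have [Y FY Yb] := sF b (mem_head b s).
have [XY|YX] := Ftot X Y FX FY; [exists Y|exists X] => // c;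
  rewrite inE => /predU1P[->|cs] //.
- by apply: XY; exact: Xs.
- exact: YX.
- exact: Xs.
Qed.

Lemma adjoin_decomp (I : set R) x (q : V) : (forall l, adjoin I x (q l)) ->
  exists j r : V, (forall l, I (j l)) /\ q = j + x *: r.
Proof.
move=> /choice[j /choice[r qE]]; exists j, r.
split=> [l|]; first by have [] := qE l.
by apply/funext => l; have [_ ->] := qE l; rewrite mulrC.
Qed.

Lemma exists_maximal_independent :
  exists B, independent B /\ forall B', B `<` B' -> ~ independent B'.
Proof.
apply: Zorn_bigcup => F FI Ftot s c us sF cs b bs.
have [X0 FX0 _] := sF b bs.
have [X FX Xs] := seq_in_chain FX0 Ftot sF.
exact: (FI X FX s c).
Qed.

Section MaximalIndependent.
Variable B : set V.
Hypothesis indB : independent B.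
Hypothesis maxB : forall B', B `<` B' -> ~ independent B'.

(** Unless [p] is in [B], adding it creates a relation modulo [enil]. The coefficient of [p] there
    is a unit, since otherwise [B] itself would be dependent, so the relation can be solved for
    [p]. *)
Lemma maximal_span_mod_enil p : exists2 v, combs B v & forall l, enil (p l - v l).
Proof.
have [Bp|nBp] := pselect (B p).
  exists p; last by move=> l; rewrite subrr; exact: (ideal0 ideal_enil).
  exists [:: (1, p)]; last by rewrite /lincomb big_seq1 scale1r.
  by move=> x; rewrite inE => /eqP ->.
have [|nind] := pselect (independent (B `|` [set p])).
  move=> /maxB[]; split; first exact: subsetUl.
  by move=> /(_ p) /=; tauto.
have [s [c [us sB cs [b bs nb]]]] : exists s c, [/\ uniq s,
    (forall b, b \in s -> (B `|` [set p]) b),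
    (forall l, enil (\sum_(b <- s) c b * b l)) &
    exists2 b, b \in s & ~ enil (c b)].
  apply: contrapT => H; apply: nind => s c us sB cs b bs.
  by apply: contrapT => nb; apply: H; exists s, c; split=> //; exists b.
pose s' := rem p s.
have us' : uniq s' by exact: rem_uniq.
have s'B d : d \in s' -> B d.
  rewrite mem_rem_uniq // inE => /andP[/eqP dp ds].
  by case: (sB d ds) => // /dp.
have [ps|nps] := boolP (p \in s); last first.
  case: nb; apply: (indB us) => // d ds.
  by case: (sB d ds) => // dp; move: nps; rewrite -dp ds.
have sumE l : \sum_(b <- s) c b * b l = c p * p l + \sum_(b <- s') c b * b l.
  by rewrite (perm_big _ (perm_to_rem ps)) big_cons.
have [[z ez]|ncp] := elocal (c p); last first.
  have cs' l : enil (\sum_(b <- s') c b * b l).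
    rewrite -[X in enil X](addKr (c p * p l)) -sumE addrC.
    apply: idealB; [exact: ideal_enil|exact: cs|].
    by rewrite mulrC; exact: enilM.
  have [bp|bp] := eqVneq b p; first by case: nb; rewrite bp.
  by case: nb; apply: (indB us' _ cs') => //; rewrite mem_rem_uniq // inE bp.
exists (\sum_(b <- s') (- (z * c b)) *: b); first exact: combs_sum.
move=> l; rewrite fct_sumE.
have -> : p l - \sum_(b <- s') ((- (z * c b)) *: b) l =
    z * (\sum_(b <- s) c b * b l) - p l * (c p * z - 1).
  rewrite sumE mulrDr mulr_sumr -sumrN.
  rewrite (eq_bigr (fun b => z * (c b * b l))); first by ring.
  by move=> d _; rewrite -mulNr opprK mulrA.
apply: idealB; [exact: ideal_enil|exact: enilM|].
by apply: enilM; exists 1%N; rewrite expr1 mulrBr mulr1 ez subrr.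
Qed.

Hypothesis nR : noetherian R.

(* The ideals [I] such that every family in [I ^ L] is spanned can be enlarged
   by any [x] with [enil * x] inside [I], since modulo [enil] everything is
   spanned; as [enil] is nil, such an [x] exists outside [I] unless [I] is [R]. *)
Lemma idem_span p : exists2 v, combs B v & e *: p = e *: v.
Proof.
pose Q (I : set R) := forall p : V, (forall l, I (p l)) ->
  exists2 v, combs B v & e *: p = e *: v.
have [|I [iI QI maxI]] := noetherian_maximal (C := Q) nR.
  exists [set 0]; split; first exact: ideal_set0.
  move=> q q0; exists 0; last by congr (_ *: _); apply/funext => l; exact: q0.
  by exists [::] => //; rewrite /lincomb big_nil.
(* By maximality [I] contains [x] once all families of multiples of [x] are spanned up to families
   in [I]. *)
have extend x (D : forall r : V, exists v j : V,
    [/\ combs B v, (forall l, I (j l)) & e *: (x *: r) = e *: (v + j)]) : I x.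
  apply: (maxI (adjoin I x)); first exact: ideal_adjoin.
  - move=> q /adjoin_decomp[j [r [Ij ->]]].
    have [v [k [Bv Ik er]]] := D r.
    have [|w Bw ew] := QI (j + k).
      by move=> l; apply: idealD.
    exists (w + v); first exact: combsD.
    by rewrite !scalerDr er scalerDr -ew scalerDr addrCA [RHS]addrC.
  - exact: sub_adjoin.
  - exact: mem_adjoin.
have I1e : I (1 - e).
  apply: extend => r; exists 0, 0; split.
  - by exists [::] => //; rewrite /lincomb big_nil.
  - by move=> l; exact: ideal0.
  - by rewrite addr0 scaler0 scalerA mulrBr mulr1 ee subrr scale0r.
have extend_enil x : (forall a, enil a -> I (a * x)) -> I x.
  move=> Ix; apply: extend => r.
  have [v Bv rv] := maximal_span_mod_enil r.
  exists (x *: v), (x *: (r - v)); split; first exact: combsZ.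
    by move=> l; have := Ix _ (rv l); rewrite mulrC.
  by rewrite -scalerDr addrC subrK.
suff I1 : I 1 by apply: QI => l; rewrite -[p l]mulr1; exact: idealMl.
apply: contrapT => nI1.
(* Choose a maximal annihilator of a nonzero element of [R / I]. If [a * x] is outside [I], it has
   the same annihilator as [x], and the nilpotency of [a] then forces [x] into [I]. *)
have [|K [iK [x nIx KE] maxK]] := noetherian_maximal
    (C := [set K | exists2 x : R, ~ I x & K = colon I x]) nR.
  by exists (colon I 1); split; [exact: ideal_colon|exists 1].
rewrite {}KE in iK maxK; apply: nIx; apply: extend_enil => a [n ean].
apply: contrapT => nax.
have step y : I (y * (a * x)) -> I (y * x).
  move=> Iy; apply: (maxK (colon I (a * x))) => //; first exact: ideal_colon.
    by exists (a * x).
  by move=> z Iz; rewrite /colon /= mulrCA; exact: idealMl.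
have powI k : I (a ^+ k * x) -> I x.
  elim: k => [|k IH]; first by rewrite mul1r.
  by rewrite exprSr -mulrA => /step /IH.
apply: nax; apply: idealMl => //; apply: (powI n).
have -> : a ^+ n = (1 - e) * a ^+ n + e * a ^+ n by ring.
by rewrite ean addr0; apply: idealMr => //; exact: idealMr.
Qed.

(* If the [e * c b] are not all zero, let [J] be an ideal maximal among those
   not containing all of them. Modulo [J] they span a simple module, so every
   [e * c b] is congruent to [d b * x], where [x] is annihilated by [enil] modulo
   [J], and independence makes every [d b] nilpotent: a contradiction. *)
Lemma idem_lincomb_eq0 s c : uniq s -> (forall b, b \in s -> B b) ->
  e *: (\sum_(b <- s) c b *: b) = 0 -> forall b, b \in s -> e * c b = 0.
Proof.
move=> us sB ecs b0 b0s; apply: contrapT => nb0.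
have [|J [iJ [b1 b1s nJ] maxJ]] := noetherian_maximal
    (C := [set J | exists2 b, b \in s & ~ J (e * c b)]) nR.
  by exists [set 0]; split; [exact: ideal_set0|exists b0].
set x := e * c b1 in nJ.
have ex : e * x = x by rewrite /x mulrA ee.
(* If [a * x] is outside [J], maximality makes [x] congruent to [d * (a * x)] modulo [J]; iterating
   puts [x] in [J]. *)
have nil_x a : enil a -> J (a * x).
  move=> [n ean]; apply: contrapT => nax.
  have [j [d [Jj xE]]] : adjoin J (a * x) x.
    apply: contrapT => H; apply: nax.
    apply: (maxJ (adjoin J (a * x))); [exact: ideal_adjoin| |exact: sub_adjoin|].
      by exists b1.
    exact: mem_adjoin.
  apply: nJ; have Jpow k : J (x - (d * a) ^+ k * x).
    elim: k => [|k IH]; first by rewrite mul1r subrr; exact: ideal0.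
    have -> : x - (d * a) ^+ k.+1 * x =
        (x - (d * a) ^+ k * x) + (d * a) ^+ k * (x - d * (a * x)).
      by rewrite exprSr; ring.
    apply: idealD => //; apply: idealMl => //.
    by rewrite {1}xE addrK.
  have := Jpow n; rewrite -{2}ex exprMn.
  have -> : d ^+ n * a ^+ n * (e * x) = d ^+ n * (e * a ^+ n) * x by ring.
  by rewrite ean mulr0 mul0r subr0.
have [d dP] : exists d, forall b, b \in s -> J (e * c b - d b * x).
  suff /choice[d dP] : forall b, exists d, b \in s -> J (e * c b - d * x).
    by exists d.
  move=> b; have [bs|] := boolP (b \in s); last by exists 0.
  have [j [d [Jj eE]]] : adjoin J x (e * c b).
    apply: contrapT => H; apply: nJ.
    apply: (maxJ (adjoin J x)); [exact: ideal_adjoin| |exact: sub_adjoin|].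
      by exists b.
    exact: mem_adjoin.
  by exists d => _; rewrite eE addrK.
have nd b : b \in s -> enil (d b).
  apply: (indB us sB) => l; set y := \sum_(b <- s) _.
  have [[z ez]|//] := elocal y; case: nJ.
  have -> : x = z * (y * x).
    by rewrite -{1}ex -{1}ez -{2}ex; ring.
  apply: idealMl => //.
  have -> : y * x = - \sum_(b <- s) (e * c b - d b * x) * b l.
    have /(congr1 (fun f : V => f l)) := ecs.
    rewrite /= scaler_sumr fct_sumE => e0.
    under eq_bigr do rewrite mulrBl; rewrite sumrB.
    rewrite (_ : \sum_(i <- s) e * c i * i l = 0); last first.
      by rewrite -[RHS]e0; apply: eq_bigr => i _; rewrite -mulrA.
    rewrite sub0r opprK mulr_suml; apply: eq_bigr => i _; ring.
  apply: idealN => //; apply: ideal_sum => // i si.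
  by apply: idealMr => //; exact: dP.
apply: nJ; rewrite -[x](subrK (d b1 * x)).
by apply: idealD; [|exact: dP|exact/nil_x/nd].
Qed.

(** Makes evaluation at [F] independent of the expansion over [B]: every collected coefficient of
    the relation is killed by [e]. *)
Lemma idem_lincomb_transfer (M : lmodType R) t (F : V -> M) :
  (forall x, x \in t -> B x.2) ->
  e *: lincomb t id = 0 -> e *: lincomb t F = 0.
Proof.
move=> tB; rewrite !lincomb_undup => e0.
rewrite scaler_sumr big_seq big1 // => b bt.
rewrite scalerA (idem_lincomb_eq0 _ _ e0 bt) ?scale0r ?undup_uniq //.
by move=> d; rewrite mem_undup => /mapP[x xt ->]; exact: tB.
Qed.

End MaximalIndependent.

End PrimitiveIdempotent.

(** For idempotent [e] this is projectivity of the summand [e P], phrased on [P] itself. *)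
Definition idem_projective (R : comNzRingType) (P : lmodType R) (e : R) :=
  forall (M N : lmodType R) (g : {linear M -> N}) (f : {linear P -> N}),
    (forall y : N, exists x : M, g x = y) ->
    exists h : {linear P -> M}, forall p : P, g (h p) = e *: f p.

Lemma primitive_idem_projective (R : comNzRingType) (L : Type) (e : R) :
  noetherian R -> e * e = e -> e <> 0 ->
  (forall x, eunit e x \/ enil e x) ->
  idem_projective (L -> R^o)%type e.
Proof.
move=> nR ee e0 eloc M N g f gsurj.
have [B [indB maxB]] := exists_maximal_independent e L.
have [mu muP] := choice (fun v : L -> R^o => gsurj (f v)).
have /choice[t tP] : forall p : L -> R^o, exists t : seq (R * (L -> R^o)),
    (forall x, x \in t -> B x.2) /\ e *: p = e *: lincomb t id.
  move=> p; have [v [t tB ->] epv] := idem_span ee e0 eloc indB maxB nR p.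
  by exists t.
pose h p : M := e *: lincomb (t p) mu.
have hlin : linear h.
  move=> a p q; apply/eqP; rewrite -subr_eq0; apply/eqP.
  (* Evaluated at [mu] and multiplied by [e], [u] is the defect of linearity of [h]; evaluated at
     [id] it is killed by [e]. *)
  pose u := t (a *: p + q) ++ [seq (-1 * x.1, x.2) |
    x <- [seq (a * x.1, x.2) | x <- t p] ++ t q].
  have hu (M' : lmodType R) (F : _ -> M') : lincomb u F =
      lincomb (t (a *: p + q)) F - (a *: lincomb (t p) F + lincomb (t q) F).
    by rewrite /u lincomb_cat lincomb_scale lincomb_cat lincomb_scale scaleN1r.
  have := @idem_lincomb_transfer _ _ ee eloc _ _ indB nR _ u mu.
  rewrite !hu /h !scalerBr !scalerDr !scalerA [a * e]mulrC -!scalerA; apply.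
    move=> x; rewrite mem_cat => /orP[/(proj1 (tP _))//|/mapP[y + ->]] /=.
    rewrite mem_cat => /orP[/mapP[z zt ->]|yt]; first exact: (proj1 (tP p) z).
    exact: (proj1 (tP q) y).
  rewrite -(proj2 (tP _)) ![e *: (a *: _)]scalerA [e * a]mulrC -!scalerA.
  by rewrite -!(proj2 (tP _)) scalerDr !scalerA [e * a]mulrC subrr.
pose hM := GRing.isLinear.Build R _ M _ h hlin.
pose H : {linear (L -> R^o)%type -> M} := HB.pack h hM.
exists H => p; rewrite /= /h linearZ /lincomb linear_sum.
rewrite -linearZ (proj2 (tP p)) linearZ /lincomb linear_sum.
by congr (_ *: _); apply: eq_bigr => x _; rewrite !linearZ muP.
Qed.

Lemma idem_projective0 (R : comNzRingType) (P : lmodType R) :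
  idem_projective P 0.
Proof.
move=> M N g f _; exists (\0 : {linear P -> M}) => p /=.
by rewrite linear0 scale0r.
Qed.

Lemma idem_projectiveD (R : comNzRingType) (P : lmodType R) (e1 e2 : R) :
  idem_projective P e1 -> idem_projective P e2 -> idem_projective P (e1 + e2).
Proof.
move=> P1 P2 M N g f gsurj.
have [[h1 gh1] [h2 gh2]] := (P1 _ _ g f gsurj, P2 _ _ g f gsurj).
exists (h1 \+ h2 : {linear P -> M}) => p /=.
by rewrite linearD gh1 gh2 scalerDl.
Qed.

(* Fitting's lemma for multiplication by [x]: in an Artinian ring some
   [x ^+ n] generates the same ideal as an idempotent. *)
Lemma artinian_primitive_local (R : comNzRingType) (e : R) :
  artinian R -> (forall w, w * w = w -> e * w = 0 \/ e * w = e) ->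
  forall x, eunit e x \/ enil e x.
Proof.
move=> aR eprim x; have [n [y xn]] := artinian_pow_stable x aR.
have xn1 k : x ^+ n.+1 = x ^+ n.+1 * (x * y) ^+ k.
  have xyK : x ^+ n.+1 * (x * y) = x ^+ n.+1.
    by rewrite [in RHS]exprS [in RHS]xn; ring.
  elim: k => [|k IH]; first by rewrite mulr1.
  by rewrite [(x * y) ^+ k.+1]exprS mulrA xyK.
have [|ew0|ewe] := eprim ((x * y) ^+ n.+1).
- by rewrite {1}exprMn mulrAC -xn1 -exprMn.
- by right; exists n.+1; rewrite (xn1 n.+1) mulrCA ew0 mulr0.
- by left; exists (y * (x * y) ^+ n); rewrite [x * _]mulrA -exprS.
Qed.

(** Instead of decomposing 1, take an idempotent [e] violating [idem_projective] with maximal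
    annihilator. For idempotent [w], one of [e * w] and [e * (1 - w)] violates it too, and
    maximality makes that one equal to [e]; so [e] is primitive. *)
Lemma artinian_projective (R : comNzRingType) (L : Type) :
  noetherian R -> artinian R -> projective (L -> R^o)%type.
Proof.
move=> nR aR; pose V := (L -> R^o)%type.
suff P1 : idem_projective V 1.
  move=> M N g f gsurj; have [h gh] := P1 M N g f gsurj.
  by exists h => p; rewrite gh scale1r.
apply: contrapT => nP1.
have [|I [iI [e [ee nPe IE]] maxI]] := noetherian_maximal
    (C := [set I | exists e : R,
      [/\ e * e = e, ~ idem_projective V e & I = colon [set 0] e]]) nR.
  exists (colon [set 0] 1); split; first exact: ideal_colon (ideal_set0 R).
  by exists 1; rewrite mulr1.
have emax w : w * w = w -> ~ idem_projective V (e * w) -> e * w = e.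
  move=> ww nPw; have /(_ (1 - e * w)) : colon [set 0] (e * w) `<=` I.
    apply: maxI; first exact: ideal_colon (ideal_set0 R).
      by exists (e * w); split=> //; rewrite mulrACA ee ww.
    by move=> z; rewrite IE /colon /= mulrA => ->; rewrite mul0r.
  rewrite IE /colon /= => H; apply/eqP; rewrite eq_sym -subr_eq0; apply/eqP.
  rewrite -[RHS]H; last by rewrite mulrBl mul1r mulrACA ee ww subrr.
  by rewrite mulrBl mul1r mulrAC ee.
have e_neq0 : e <> 0.
  by move=> e0; apply: nPe; rewrite e0; exact: idem_projective0.
apply: (nPe); apply: primitive_idem_projective => //.
apply: artinian_primitive_local => // w ww.
have [Pw|/emax] := pselect (idem_projective V (e * w)); last by right; auto.
have [Pv|nPv] := pselect (idem_projective V (e * (1 - w))).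
  case: nPe; rewrite (_ : e = e * w + e * (1 - w)); last by ring.
  exact: idem_projectiveD.
left; have /emax /(_ nPv) : (1 - w) * (1 - w) = 1 - w.
  by rewrite mulrBr mulr1 mulrBl mul1r ww subrr subr0.
by rewrite mulrBr mulr1 => /eqP; rewrite subr_eq addrC -subr_eq subrr
  => /eqP.
Qed.

(** * Projectivity of the product *)

(* Take [p] maximal among the ideals [I] such that [R / I] is not Artinian. *)
Lemma not_artinian_prime (R : comNzRingType) : noetherian R -> ~ artinian R ->
  exists (p : set R) (x : R), [/\ is_ideal p, ~ p 1,
    (forall a b, p (a * b) -> p a \/ p b), ~ p x & forall y, ~ p (1 - x * y)].
Proof.
move=> nR naR.
pose dcc (I : set R) := forall J : nat -> set R, (forall n, is_ideal (J n)) ->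
  (forall n, J n.+1 `<=` J n) -> (forall n, I `<=` J n) ->
  exists m, forall n, (m <= n)%N -> J n = J m.
have [|p [ip np maxp]] := noetherian_maximal (C := [set I | ~ dcc I]) nR.
  exists [set 0]; split; first exact: ideal_set0.
  by move=> d0; apply: naR => J iJ JS; apply: d0 => // n z ->; exact: ideal0.
have dccW (I : set R) z : is_ideal I -> p `<=` I -> I z -> ~ p z -> dcc I.
  move=> iI pI Iz npz; apply: contrapT => nI; apply: npz.
  exact: (maxp I).
have np1 : ~ p 1.
  move=> p1; apply: np => J iJ JS pJ; exists 0%N => n _.
  have JT k : J k = setT.
    rewrite -subTset => z _; rewrite -[z]mulr1; apply: idealMl => //; exact: pJ.
  by rewrite !JT.
(* If [a] and [b] were outside [p], then [adjoin p a] and [colon p a] would both strictly contain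
   [p]; and a chain [J] stabilizes as soon as [adjoin (J n) a] and [colon (J n) a] do. *)
have pprime a b : p (a * b) -> p a \/ p b.
  move=> pab; have [|npa] := pselect (p a); [by left|right].
  apply: contrapT => npb; apply: np => J iJ JS pJ.
  have [|||||m1 J1] := dccW _ a (ideal_adjoin a ip) _ _ npa
    (fun n => adjoin (J n) a).
  - exact: sub_adjoin.
  - exact: mem_adjoin.
  - by move=> n; exact: ideal_adjoin.
  - by move=> n z [j [c [Jj ->]]]; exists j, c; split=> //; exact: JS.
  - by move=> n z [j [c [Jj ->]]]; exists j, c; split=> //; exact: pJ.
  have [|||||m2 J2] := dccW _ b (ideal_colon a ip) _ _ npb
    (fun n => colon (J n) a).
  - exact: sub_colon.
  - by rewrite /colon /= mulrC.
  - by move=> n; exact: ideal_colon.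
  - by move=> n z; exact: JS.
  - by move=> n z; exact: pJ.
  pose m := maxn m1 m2; exists m => n mn.
  apply/seteqP; split; first exact: nonincreasing_ideals.
  move=> z Jmz.
  have [j [c [Jj zE]]] : adjoin (J n) a z.
    rewrite (J1 n) ?(leq_trans (leq_maxl m1 m2)) //.
    rewrite -(J1 m) ?leq_maxl //; exact: sub_adjoin.
  have Jc : colon (J n) a c.
    rewrite (J2 n) ?(leq_trans (leq_maxr m1 m2)) //.
    rewrite -(J2 m) ?leq_maxr // /colon /=.
    rewrite (_ : c * a = z - j); last by rewrite zE addrC addKr.
    by apply: idealB => //; apply: (nonincreasing_ideals JS mn).
  by rewrite zE; exact: idealD.
suff [x [npx nx]] : exists x, ~ p x /\ forall y, ~ p (1 - x * y).
  by exists p, x.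
(* Otherwise [R / p] is a field, and a descending chain above [p] reaches [p] or is constantly
   [R]. *)
apply: contrapT => H; apply: np => J iJ JS pJ.
have [[m Jm]|HJ] := pselect (exists m, J m `<=` p).
  exists m => n mn; apply/seteqP; split; first exact: nonincreasing_ideals.
  by move=> z /Jm; exact: pJ.
have JT n : J n = setT.
  suff Jn1 : J n 1.
    rewrite -subTset => z _; rewrite -[z]mulr1; exact: idealMl.
  apply: contrapT => nJ1; apply: HJ; exists n => z Jz.
  apply: contrapT => npz; apply: H; exists z; split=> // y py.
  apply: nJ1; rewrite -[1](subrK (z * y)); apply: idealD => //; first exact: pJ.
  exact: idealMr.
by exists 0%N => n _; rewrite !JT.
Qed.

Lemma prime_cancel_exp (R : comNzRingType) (p : set R) (x y : R) n :
  (forall a b, p (a * b) -> p a \/ p b) -> ~ p x -> p (x ^+ n * y) -> p y.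
Proof.
move=> pprime npx; elim: n => [|n IH]; first by rewrite mul1r.
by rewrite exprS -mulrA => /pprime[//|].
Qed.

(** Krull's intersection theorem in the domain [R / p]: there [z] is [y n * x ^+ n], so [y n] equals
    [x * y n.+1]. The ascending ideals of the [y n] stabilize, so [(1 - x * a) * y m] vanishes, and
    with it [y m] and [z]. *)
Lemma prime_krull (R : comNzRingType) (p : set R) (x : R) : noetherian R ->
  is_ideal p -> (forall a b, p (a * b) -> p a \/ p b) -> ~ p x ->
  (forall y, ~ p (1 - x * y)) ->
  forall z, (forall n, adjoin p (x ^+ n) z) -> p z.
Proof.
move=> nR ip pprime npx ninv z zx.
have [y yP] : exists y, forall n, p (z - y n * x ^+ n).
  suff /choice[y yP] : forall n, exists y, p (z - y * x ^+ n) by exists y.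
  move=> n.
  by have [j [a [pj ->]]] := zx n; exists a; rewrite addrK.
have yS n : p (y n - x * y n.+1).
  apply: (prime_cancel_exp (n := n) pprime npx).
  rewrite (_ : _ * _ = (z - y n.+1 * x ^+ n.+1) - (z - y n * x ^+ n)).
    exact: idealB.
  by rewrite exprS; ring.
have [||m mE] := nR (fun n => adjoin p (y n)).
- by move=> n; exact: ideal_adjoin.
- move=> n; apply: adjoin_sub; [exact: ideal_adjoin|exact: sub_adjoin|].
  by exists (y n - x * y n.+1), x; rewrite subrK.
have [j [a [pj yE]]] : adjoin p (y m) (y m.+1).
  by rewrite -(mE m.+1) //; exact: mem_adjoin.
have : p ((1 - x * a) * y m).
  rewrite (_ : (1 - _) * _ = (y m - x * y m.+1) + x * j); last by rewrite yE; ring.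
  by apply: idealD => //; exact: idealMl.
move=> /pprime[/ninv//|pym]; rewrite -[z](subrK (y m * x ^+ m)).
by apply: idealD => //; exact: idealMr.
Qed.

(** * Dual bases of projective modules *)

Section DualBasis.
Variables (R : nzRingType) (P : lmodType R).

Definition finsupp : {pred P -> R^o} :=
  [pred c | `[< exists s : seq P, forall v, c v <> 0 -> v \in s >]].

Lemma finsupp_closed : GRing.submod_closed finsupp.
Proof.
split; first by apply/asboolP; exists [::].
move=> a c d /asboolP[s sP] /asboolP[t tP]; apply/asboolP; exists (s ++ t) => v.
rewrite mem_cat; have [//|nvs] := boolP (v \in s).
have [//|nvt] := boolP (v \in t); case.
have cv : c v = 0 by apply: contrapT => /sP; exact/negP.
have dv : d v = 0 by apply: contrapT => /tP; exact/negP.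
by transitivity (a * c v + d v) => //; rewrite cv dv mulr0 addr0.
Qed.

HB.instance Definition _ := GRing.isSubmodClosed.Build R (P -> R^o)%type finsupp
  (GRing.submod_closed_semi finsupp_closed).

Definition freemod := {c : P -> R^o | finsupp c}.
HB.instance Definition _ := SubChoice.on freemod.
HB.instance Definition _ := [SubChoice_isSubLmodule of freemod by <:].

(** Frees [free_total] from the arbitrary choice of a list covering the support. *)
Lemma sum_support_eq (c : P -> R) (s t : seq P) : uniq s -> uniq t ->
  (forall v, c v <> 0 -> v \in s) -> (forall v, c v <> 0 -> v \in t) ->
  \sum_(v <- s) c v *: v = \sum_(v <- t) c v *: v.
Proof.
have nz r : \sum_(v <- r) c v *: v = \sum_(v <- [seq v <- r | c v != 0]) c v *: v.
  rewrite big_filter [LHS](bigID (fun v => c v != 0)) /=.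
  rewrite [X in _ + X]big1 ?addr0 // => v.
  by rewrite negbK => /eqP ->; rewrite scale0r.
move=> us ut sc tc; rewrite nz [RHS]nz; apply: perm_big.
apply: uniq_perm; rewrite ?filter_uniq // => v; rewrite !mem_filter.
by have [//|/eqP cv] := eqVneq (c v) 0; rewrite sc ?tc.
Qed.

Definition free_support (c : freemod) : seq P := sval (cid (asboolW (valP c))).

Lemma free_supportP (c : freemod) v : val c v <> 0 -> v \in free_support c.
Proof. by rewrite /free_support; case: cid => s /=; exact. Qed.

Definition free_total (c : freemod) : P :=
  \sum_(v <- undup (free_support c)) val c v *: v.

Lemma free_totalE (c : freemod) s : uniq s ->
  (forall v, val c v <> 0 -> v \in s) ->
  free_total c = \sum_(v <- s) val c v *: v.
Proof.
move=> us sc; apply: sum_support_eq => //; first exact: undup_uniq.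
by move=> v; rewrite mem_undup; exact: free_supportP.
Qed.

Lemma free_total_linear : linear free_total.
Proof.
move=> a c d; pose s := undup (free_support (a *: c + d) ++
  (free_support c ++ free_support d)).
have ss e : {subset free_support e <= s} ->
    free_total e = \sum_(v <- s) val e v *: v.
  move=> es; apply: free_totalE; first exact: undup_uniq.
  by move=> v /free_supportP; exact: es.
rewrite !ss; try by move=> v vs; rewrite mem_undup !mem_cat vs ?orbT.
rewrite scaler_sumr -big_split; apply: eq_bigr => v _ /=.
by rewrite scalerA -scalerDl.
Qed.

HB.instance Definition _ :=
  GRing.isLinear.Build R freemod P _ free_total free_total_linear.

Lemma free_total_surj (y : P) : exists c, free_total c = y.
Proof.
pose d (v : P) : R^o := (v == y)%:R.
have dy v : d v <> 0 -> v \in [:: y].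
  by rewrite /d inE; case: eqP.
have fd : finsupp d by apply/asboolP; exists [:: y].
exists (exist _ d fd); rewrite (@free_totalE _ [:: y]) // big_seq1.
by rewrite /= /d eqxx scale1r.
Qed.

(** The functionals are the coordinates of a section of the surjection [free_total], so the index
    set is [P] itself. *)
Lemma projective_dual_basis : projective P ->
  exists phi : P -> {linear P -> R^o},
    (forall p, exists s : seq P, forall i, phi i p <> 0 -> i \in s) /\
    forall p s, uniq s -> (forall i, phi i p <> 0 -> i \in s) ->
      p = \sum_(i <- s) phi i p *: i.
Proof.
move=> /(_ freemod P free_total idfun free_total_surj)[h hK].
have phil i : linear (fun p => val (h p) i : R^o).
  by move=> a u v; rewrite linearP.
pose phi i : {linear P -> R^o} :=
  HB.pack (fun p => val (h p) i : R^o) (GRing.isLinear.Build R P R^o _ _ (phil i)).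
exists phi; split=> [p|p s us sp].
  by exists (free_support (h p)) => i; exact: free_supportP.
by rewrite -[LHS]hK; exact: free_totalE.
Qed.

End DualBasis.

(** * Determinants *)

Lemma det_mul_thin (R : comNzRingType) (d : nat)
  (A : 'M[R]_(d + 1, d)) (B : 'M[R]_(d, d + 1)) : \det (A *m B) = 0.
Proof.
(* Padded to square matrices, the left factor has a zero column. *)
have -> : A *m B = row_mx A 0 *m col_mx B (0 : 'M_(1, d + 1)).
  by rewrite mul_row_col mulmx0 addr0.
rewrite det_mulmx (expand_det_col _ (rshift d ord0)) big1 ?mul0r // => i _.
by rewrite row_mxEr mxE mul0r.
Qed.

(** Replaces reduction of matrices to [R / p]: the determinant is polynomial in the entries. *)
Lemma det_congr_ideal (R : comNzRingType) (p : set R) (n : nat) (A B : 'M[R]_n) :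
  is_ideal p -> (forall i j, p (A i j - B i j)) -> p (\det A - \det B).
Proof.
move=> ip pAB; rewrite /determinant -sumrB.
apply: (big_ind p) => [|x y|s _]; [exact: ideal0|exact: idealD|].
rewrite -mulrBr; apply: idealMl => //.
apply: (big_ind2 (fun x y => p (x - y))) => [|x y z t pxy pzt|i _ //].
  by rewrite subrr; exact: ideal0.
rewrite (_ : _ - _ = (x - y) * z + y * (z - t)); last by ring.
by apply: idealD => //; [exact: idealMr|exact: idealMl].
Qed.

(** * Chase's gliding hump argument *)

Section Chase.
Variables (R : comNzRingType) (L : Type).
Local Notation V := (L -> R^o)%type.
Variable (idx : L -> nat).

(** [idx] cuts [L] into layers, so a series with [n]-th term in [tail n] is a finite sum at every
    coordinate. *)
Definition tail (n : nat) : set V := [set v | forall l, (idx l < n)%N -> v l = 0].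

Variable phi : V -> {linear V -> R^o}.
Hypothesis phi_fin :
  forall v, exists s : seq V, forall i, phi i v <> 0 -> i \in s.

(* If this fails, one builds a convergent series [\sum_n x ^+ K n *: v n] with
   [v n] in [tail n] that has infinitely many nonzero coordinates: the n-th term
   has a nonzero coordinate modulo [p] and a power of [x], at an index where the
   previous terms vanish, and the later terms are divisible by that power. *)
Lemma chase (p : set R) (x : R) : is_ideal p ->
  exists K n (F : seq V), forall i, i \notin F -> forall v, tail n v ->
    forall m, adjoin p (x ^+ m) (phi i (x ^+ K *: v)).
Proof.
move=> ip; apply: contrapT => H.
have step (a : nat * nat * seq V) : exists b : V * V * nat,
    [/\ b.1.1 \notin a.2, tail a.1.2 b.1.2 &
        ~ adjoin p (x ^+ b.2) (phi b.1.1 (x ^+ a.1.1 *: b.1.2))].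
  case: a => [[K n] F] /=; apply: contrapT => H'; apply: H; exists K, n, F.
  move=> i iF v vn m; apply: contrapT => nm.
  by apply: H'; exists (i, v, m).
have [f fP] := choice step.
have [S SP] := choice phi_fin.
(* The state holds the exponent [K n] and the list [F n] of forbidden indices: those already chosen
   and the supports of the earlier terms. *)
pose st := fix st n : nat * seq V := if n is k.+1 then
    let: b := f ((st k).1, k, (st k).2) in
    ((st k).1 + b.2,
      b.1.1 :: (st k).2 ++ S (x ^+ (st k).1 *: b.1.2))%N
  else (0%N, [::]).
pose K n := (st n).1; pose F n := (st n).2.
pose i n := (f (K n, n, F n)).1.1.
pose v n := (f (K n, n, F n)).1.2.
pose m n := (f (K n, n, F n)).2.
pose q n := x ^+ K n *: v n.
have KS n : K n.+1 = (K n + m n)%N by [].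
have FS n : F n.+1 = i n :: F n ++ S (q n) by [].
have iF n : i n \notin F n by have [] := fP (K n, n, F n).
have vn n : tail n (v n) by have [] := fP (K n, n, F n).
have nphi n : ~ adjoin p (x ^+ m n) (phi (i n) (q n)).
  by have [] := fP (K n, n, F n).
have Kmono a b : (a <= b)%N -> (K a <= K b)%N.
  move=> /subnK <-; elim: (b - a)%N => [//|k IH].
  by rewrite addSn KS (leq_trans IH) // leq_addr.
have Fmono a b : (a <= b)%N -> {subset F a <= F b}.
  move=> /subnK <-; elim: (b - a)%N => [//|k IH] z /IH zF.
  by rewrite addSn FS inE mem_cat zF orbT.
(* The [n]-th remainder of the series, divided by [x ^+ K n]; terms beyond [idx l] vanish at [l]. *)
pose w n : V := fun l => \sum_(n <= j < (idx l).+1) x ^+ (K j - K n) * v j l.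
have wS n : w n = v n + x ^+ m n *: w n.+1.
  apply/funext => l; transitivity (v n l + x ^+ m n * w n.+1 l) => //.
  rewrite /w; have [nl|nl] := ltnP (idx l) n.
    by rewrite !big_geq ?vn ?mulr0 ?addr0 // ltnW.
  rewrite big_ltn // subnn mul1r; congr (_ + _).
  rewrite mulr_sumr [LHS]big_nat_cond [RHS]big_nat_cond; apply: eq_bigr => j.
  rewrite andbT => /andP[nj _]; rewrite mulrA -exprD; congr (x ^+ _ * _).
  by rewrite KS subnDA subnKC // leq_subRL ?Kmono ?(ltnW nj) // -KS Kmono.
have w0 n : w 0%N = \sum_(0 <= j < n) q j + x ^+ K n *: w n.
  elim: n => [|n IH]; first by rewrite big_geq // add0r scale1r.
  by rewrite big_nat_recr //= IH {1}wS scalerDr scalerA -exprD -KS addrA.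
(* [phi (i n)] kills the earlier terms, as [F n] covers their supports; it maps the remainder to a
   multiple of [x ^+ K n.+1], hence of [x ^+ m n], which cannot cancel the [n]-th term. *)
have phi_w0 n : phi (i n) (w 0%N) <> 0.
  rewrite (w0 n.+1) big_nat_recr //= !linearD linear_sum.
  rewrite big_nat_cond big1 => [|j /andP[/andP[_ jn] _]]; last first.
    apply: contrapT => /SP iS; have /negP := iF n; apply.
    by apply: (Fmono j.+1) => //; rewrite FS inE mem_cat iS !orbT.
  rewrite add0r => /eqP; rewrite addr_eq0 => /eqP E; apply: (nphi n).
  exists 0, (- x ^+ K n * phi (i n) (w n.+1)).
  split; first exact: ideal0.
  have -> : phi (i n) (q n) = - (x ^+ K n.+1 * phi (i n) (w n.+1)).
    by rewrite E linearZ.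
  by rewrite KS exprD; ring.
have i_inj : injective i.
  have lt a b : (a < b)%N -> i a <> i b.
    move=> ab iab; have /negP := iF b; apply; rewrite -iab.
    by apply: (Fmono a.+1) => //; rewrite FS mem_head.
  by move=> a b iab; case: (ltngtP a b) => // /lt; rewrite iab.
pose N := (size (S (w 0%N))).+1.
have : (size [seq i n | n <- iota 0 N] <= size (S (w 0%N)))%N.
  apply: uniq_leq_size; first by rewrite map_inj_uniq // iota_uniq.
  by move=> _ /mapP[n _ ->]; exact/SP/phi_w0.
by rewrite size_map size_iota ltnn.
Qed.

End Chase.

Lemma projective_artinian (R : comNzRingType) (L : Type) :
  noetherian R -> infinite_set [set: L] ->
  projective (L -> R^o)%type -> artinian R.
Proof.
move=> nR infL projV; apply: contrapT => naR.
have [p [x [ip np1 pprime npx ninv]]] := not_artinian_prime nR naR.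
have [phi [phi_fin phi_sum]] := projective_dual_basis projV.
have [idx [pt ptK]] : exists (idx : L -> nat) (pt : nat -> L), cancel pt idx.
  have /infiniteP/pcard_geP/surjPex[idx idx_surj] := infL.
  have /choice[pt ptK] : forall n, exists l, idx l = n.
    by move=> n; have [l _ <-] := idx_surj n I; exists l.
  by exists idx, pt.
have [K [n [F0 chaseF]]] := chase idx phi_fin x ip.
pose F := undup F0; pose d := size F.
(* [x ^+ K * phi i v] lies in every [p + (x ^+ m)], hence in [p], and the prime [p] allows
   cancelling [x ^+ K]. *)
have phi_tail i v : i \notin F -> tail idx n v -> p (phi i v).
  rewrite mem_undup => iF vn; apply: (prime_cancel_exp (n := K) pprime npx).
  apply: (prime_krull nR ip pprime npx ninv) => m.
  by have := chaseF i iF v vn m; rewrite linearZ.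
pose e j : L -> R^o := fun l => (idx l == n + j)%:R.
have etail j : tail idx n (e j).
  by move=> l ln; rewrite /e ltn_eqF // (leq_trans ln) // leq_addr.
pose A : 'M[R]_(d + 1, d) := \matrix_(j, i) phi (tnth (in_tuple F) i) (e j).
pose B : 'M[R]_(d, d + 1) := \matrix_(i, t) (tnth (in_tuple F) i) (pt (n + t)%N).
(* Evaluating the expansion of [e j] at [pt (n + t)] gives the entries of the identity matrix; terms
   with index outside [F] lie in [p]. *)
have AB j t : p ((1%:M : 'M[R]_(d + 1)) j t - (A *m B) j t).
  have [s sP] := phi_fin (e j).
  pose s' := [seq i <- undup s | i \notin F].
  have us : uniq (F ++ s').
    rewrite cat_uniq undup_uniq filter_uniq ?undup_uniq // andbT.
    by apply/hasPn => i; rewrite mem_filter => /andP[].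
  have := phi_sum (e j) _ us.
  have cov i : phi i (e j) <> 0 -> i \in F ++ s'.
    move=> /sP si; rewrite mem_cat mem_filter mem_undup si andbT.
    by rewrite orbN.
  move=> /(_ cov) /(congr1 (fun v : L -> R^o => v (pt (n + t)%N))).
  rewrite /= fct_sumE big_cat /= => E.
  have E' : e j (pt (n + t)%N) = \sum_(i <- F) phi i (e j) * i (pt (n + t)%N) +
    \sum_(i <- s') phi i (e j) * i (pt (n + t)%N) :> R by exact: E.
  have -> : (1%:M : 'M[R]_(d + 1)) j t = e j (pt (n + t)%N).
    by rewrite mxE /e ptK eqn_add2l eq_sym.
  rewrite {}E' mxE.
  have -> : \sum_i A j i * B i t =
      \sum_(i <- F) phi i (e j) * i (pt (n + t)%N) :> R.
    rewrite (big_nth 0) big_mkord; apply: eq_bigr => i _.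
    by rewrite !mxE !(tnth_nth 0).
  rewrite addrC addKr; apply: ideal_sum => // i.
  rewrite mem_filter => /andP[iF _]; apply: idealMr => //.
  exact: phi_tail.
by have := det_congr_ideal ip AB; rewrite det1 det_mul_thin subr0.
Qed.

Theorem theorem4p51 (R : comNzRingType) (L : Type) :
  noetherian R -> infinite_set [set: L] ->
  (projective (L -> R^o)%type <-> artinian R).
Proof.
move=> nR infL; split; first exact: projective_artinian.
exact: artinian_projective.
Qed.
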